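(* There exist linearly stable relative equilibria of the $4$-vortex problem without a line of symmetry.
   Context: Write $(x,y)^\perp=(-y,x)$. The $4$-vortex problem with nonzero real circulations $\Gamma_0,\dots,\Gamma_3$ is the system $\dot q_i=\sum_{j\ne i}\Gamma_j (q_i-q_j)^\perp/|q_i-q_j|^2$, $q_i\in\mathbb{R}^2$, $i=0,\dots,3$. A relative equilibrium with rotation rate $\omega$ is a configuration of distinct points $q_0,\dots,q_3$, with center of vorticity at the origin ($\sum_i\Gamma_iq_i=0$), such that $\omega\Gamma_i q_i^\perp+\sum_{j\ne i}\Gamma_i\Gamma_j (q_j-q_i)^\perp/|q_i-q_j|^2=0$ for all $i$; equivalently, rotating the configuration rigidly with angular velocity $\omega$ about the origin gives a solution. The rotation rate is normalized to $\omega=1$. Line of symmetry: a line in the plane such that reflection in it maps the set of the four vortex positions $\{q_0,q_1,q_2,q_3\}$ onto itself. Linear stability: circulations are of the form $\Gamma_0=1$, $\Gamma_i=\varepsilon\mu_i$ ($i=1,2,3$), with $\varepsilon>0$, $\mu_i\in\mathbb{R}\setminus\{0\}$ and $\Gamma_T=\sum_{i=0}^3\Gamma_i\ne0$. Heliocentric coordinates are $Z_i=q_i-q_0=(X_i,Y_i)=(r_i\cos\theta_i,r_i\sin\theta_i)$, $i=1,2,3$. In the frame rotating with rate $1$ the equations of motion in the coordinates $(r,\theta)\in\mathbb{R}^6$ are $$\dot r_i=\varepsilon\sum_{j\ne i}\mu_jr_j\sin(\theta_i-\theta_j)\Big(\frac1{r_j^2}-\frac1{r_i^2+r_j^2-2r_ir_j\cos(\theta_i-\theta_j)}\Big),$$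 $$\dot\theta_i=-1+\frac{1+\varepsilon\mu_i}{r_i^2}+\varepsilon\sum_{j\ne i}\mu_j\frac{r_i^2r_j\cos(\theta_i-\theta_j)-r_ir_j^2\cos(2(\theta_i-\theta_j))}{r_ir_j^2\,(r_i^2+r_j^2-2r_ir_j\cos(\theta_i-\theta_j))},$$ for $i=1,2,3$ (sums over $j\in\{1,2,3\}$), and relative equilibria are fixed points $(r,\theta)$ of this system. Let $M$ be the $6\times6$ matrix of the linearization at the fixed point. Rotational and scaling symmetry give a two-dimensional $M$-invariant subspace $S$ spanned by $(\delta r,\delta\theta)=(0,0,0,1,1,1)$ and $(\delta r,\delta\theta)=(r_1,r_2,r_3,0,0,0)$. The system is Hamiltonian with respect to the symplectic form $\Omega=\sum_{i=1}^3\Gamma_i\,dY_i\wedge dX_i-\frac1{\Gamma_T}\big(\sum_{i=1}^3\Gamma_i\,dY_i\big)\wedge\big(\sum_{j=1}^3\Gamma_j\,dX_j\big)$ (expressed in polar coordinates). The relative equilibrium is linearly stable if, on the subspace skew-orthogonal (with respect to $\Omega$) to $S$, $M$ has purely imaginary eigenvalues and no nontrivial Jordan blocks. *)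

(* Defs.v *)
(* MathComp-Analysis; points and tangent vectors are row vectors, so linear
   maps act by right multiplication. *)
From HB Require Import structures.
From mathcomp Require Import all_boot all_order all_algebra.
From mathcomp Require Import all_classical all_reals all_analysis.
From mathcomp Require Import complex.

Set Implicit Arguments.
Unset Strict Implicit.
Unset Printing Implicit Defensive.

Import Order.TTheory GRing.Theory Num.Theory.
Import numFieldNormedType.Exports.

Local Open Scope classical_set_scope.
Local Open Scope ring_scope.

Section Plane.
Variable R : realType.
Implicit Types u v a n x : 'rV[R]_2.

(* The library norm on 'rV[R]_2 is the sup norm: Euclidean lengths are obtained
   from this inner product. *)
Definition dot u v : R := \sum_(k < 2) u 0 k * v 0 k.

Definition perp v : 'rV[R]_2 :=
  \row_(k < 2) if k == 0 then - v 0 1 else v 0 0.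

(* The line through a with normal vector n (nonzero, not necessarily unit). *)
Definition reflection a n x : 'rV[R]_2 :=
  x - (2 * dot (x - a) n / dot n n) *: n.

Definition has_line_of_symmetry N (q : 'I_N -> 'rV[R]_2) : Prop :=
  exists a n, n != 0 /\ reflection a n @` range q = range q.

Definition relative_equilibrium N (Gam : 'I_N -> R) (omega : R)
    (q : 'I_N -> 'rV[R]_2) : Prop :=
  [/\ injective q,
      \sum_i Gam i *: q i = 0 &
      forall i, (omega * Gam i) *: perp (q i)
        + \sum_(j | j != i)
            (Gam i * Gam j / dot (q i - q j) (q i - q j)) *: perp (q j - q i)
        = 0].

End Plane.

Section Heliocentric.
Variable R : realType.

(* Index i : 'I_3 stands for the vortex lift ord0 i : 'I_4. *)
Definition circulation (eps : R) (mu : 'I_3 -> R) (i : 'I_4) : R :=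
  if unlift ord0 i is Some j then eps * mu j else 1.

(* A state is (r_1, r_2, r_3, theta_1, theta_2, theta_3). *)
Definition radius (s : 'rV[R]_(3 + 3)) (i : 'I_3) : R := s 0 (lshift 3 i).
Definition angle (s : 'rV[R]_(3 + 3)) (i : 'I_3) : R := s 0 (rshift 3 i).

Definition polar_of (q : 'I_4 -> 'rV[R]_2) (s : 'rV[R]_(3 + 3)) : Prop :=
  forall i : 'I_3,
    [/\ 0 < radius s i,
        (q (lift ord0 i) - q ord0) 0 0 = radius s i * cos (angle s i) &
        (q (lift ord0 i) - q ord0) 0 1 = radius s i * sin (angle s i)].

Section Dynamics.
Variables (eps : R) (mu : 'I_3 -> R).

Definition sqdist (s : 'rV[R]_(3 + 3)) (i j : 'I_3) : R :=
  radius s i ^+ 2 + radius s j ^+ 2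
  - 2 * radius s i * radius s j * cos (angle s i - angle s j).

Definition rdot (s : 'rV[R]_(3 + 3)) (i : 'I_3) : R :=
  eps * \sum_(j | j != i)
    mu j * radius s j * sin (angle s i - angle s j)
    * (1 / radius s j ^+ 2 - 1 / sqdist s i j).

Definition thetadot (s : 'rV[R]_(3 + 3)) (i : 'I_3) : R :=
  - 1 + (1 + eps * mu i) / radius s i ^+ 2
  + eps * \sum_(j | j != i)
      mu j * ((radius s i ^+ 2 * radius s j * cos (angle s i - angle s j)
               - radius s i * radius s j ^+ 2
                 * cos (2 * (angle s i - angle s j)))
              / (radius s i * radius s j ^+ 2 * sqdist s i j)).

(* The equations of motion in the frame rotating with rate 1. *)
Definition vortex_field (s : 'rV[R]_(3 + 3)) : 'rV[R]_(3 + 3) :=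
  row_mx (\row_i rdot s i) (\row_i thetadot s i).

(* (s |-> (X_1, X_2, X_3, Y_1, Y_2, Y_3)) *)
Definition cartesian (s : 'rV[R]_(3 + 3)) : 'rV[R]_(3 + 3) :=
  row_mx (\row_i (radius s i * cos (angle s i)))
         (\row_i (radius s i * sin (angle s i))).

Definition dX (i : 'I_3) (u : 'rV[R]_(3 + 3)) : R := u 0 (lshift 3 i).
Definition dY (i : 'I_3) (u : 'rV[R]_(3 + 3)) : R := u 0 (rshift 3 i).

Definition wedge (a b : 'rV[R]_(3 + 3) -> R) (u v : 'rV[R]_(3 + 3)) : R :=
  a u * b v - a v * b u.

Definition Omega (u v : 'rV[R]_(3 + 3)) : R :=
  let G i := circulation eps mu (lift ord0 i) in
  \sum_i G i * wedge (dY i) (dX i) u v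
  - (\sum_i circulation eps mu i)^-1
    * wedge (fun w => \sum_i G i * dY i w) (fun w => \sum_j G j * dX j w) u v.

(* Gram matrix at s of the pull-back of Omega to polar coordinates. *)
Definition Omega_polar (s : 'rV[R]_(3 + 3)) : 'M[R]_(3 + 3) :=
  \matrix_(i, j) Omega ('d cartesian s (delta_mx 0 i))
                       ('d cartesian s (delta_mx 0 j)).

(* The row space is S, spanned by the rotation and scaling directions. *)
Definition symmetry_space (s : 'rV[R]_(3 + 3)) : 'M[R]_(1 + 1, 3 + 3) :=
  col_mx (row_mx 0 (const_mx 1)) (row_mx (\row_i radius s i) 0).

(* The row space is the skew-orthogonal complement of S: the vectors u with
   u *m Omega_polar s *m w^T = 0 for all w in S. *)
Definition skew_orthogonal (s : 'rV[R]_(3 + 3)) : 'M[R]_(3 + 3) :=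
  kermx (Omega_polar s *m (symmetry_space s)^T).

(* The linearization at s on the skew-orthogonal complement of S, with
   complexified coefficients. *)
Definition reduced_linearization (s : 'rV[R]_(3 + 3)) :
    'M[R[i]]_(\rank (skew_orthogonal s)) :=
  map_mx (real_complex R)
    (restrictmx (skew_orthogonal s) (jacobian vortex_field s)).

(* Absence of nontrivial Jordan blocks, i.e., a diagonal Jordan form, is
   diagonalizability over the complex numbers. *)
Definition linearly_stable (q : 'I_4 -> 'rV[R]_2) : Prop :=
  exists s : 'rV[R]_(3 + 3),
    [/\ polar_of q s,
        vortex_field s = 0,
        forall a : R[i],
          eigenvalue (reduced_linearization s) a -> complex.Re a = 0 &
        diagonalizable (reduced_linearization s)].

End Dynamics.
End Heliocentric.

(* Main.v *)
Require Import Defs.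
From mathcomp Require Import all_boot all_order all_algebra.
From mathcomp Require Import all_classical all_reals all_analysis.
From HB Require Import structures.
From mathcomp Require Import complex ring lra.
(* The last import makes radius denote the polar coordinate. *)
Import Defs.

Import Order.TTheory GRing.Theory Num.Theory.
Import numFieldNormedType.Exports.
Local Open Scope ring_scope.

Set Implicit Arguments.
Unset Strict Implicit.
Unset Printing Implicit Defensive.

(** An explicit configuration is exhibited.  Its circulations are proportional
    to 143 : 44 : 65 : 35, and its squared distances to

      d01 = 33, d02 = 26, d03 = 24, d12 = 20, d13 = 15, d23 = 50.

    Four points in the plane form a relative equilibrium for suitable
    circulations when the three products
      (1/d01 - l)(1/d23 - l), (1/d02 - l)(1/d13 - l), (1/d03 - l)(1/d12 - l)
    of opposite edges agree for some l (Dziobek's relations).  Here l = 1/28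
    makes all three equal to 1/15 in units of l^2.  The six distances are
    pairwise distinct, so an isometry that permutes the points fixes each of
    them, and a reflection cannot fix three points that are not collinear:
    this is [config_asymmetric].  With one square root w of 39 for the area of
    the triangles, and one length unit a chosen so that the rotation rate is 1,
    everything else is rational.

    For stability, write a tangent vector as zeta_k = dr_k / r_k + i dtheta_k.
    The symmetry space S is the complex line spanned by (1, 1, 1), and the
    linearization is zeta |-> - i zeta + K conj(zeta) for a complex 3 x 3
    matrix K.  Its square W = K conj(K) - 1 is therefore complex linear.
    The skew-orthogonal complement of S is the kernel of a complex linear form
    h, and W^2 + al W + be = c (1, 1, 1)^T h with al, be > 0, al^2 > 4 be; this
    is [fourth_iterate].  Hence the reduced linearization is annihilated by
    X^4 + al X^2 + be, which has four distinct purely imaginary roots: its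
    eigenvalues are among them, and it is diagonalizable
    ([biquadratic_eigenvalue], [biquadratic_diagonalizable]).

    What links these computations to the vortex field is its differential
    ([is_diff_vortex_field]) and the pull-back of the symplectic form
    ([skew_orthogonalP]); [linearly_stableP] reduces stability to identities
    between coordinates of tangent vectors. *)

(** * Matrices annihilated by a biquadratic polynomial *)

(** The restriction of f to V is intertwined with f by the row-free matrix
    row_base V, so an identity on the vectors of V descends to it. *)
Lemma restrictmx_quartic (F : fieldType) (n : nat) (V f : 'M[F]_n) (al be : F) :
  (forall u : 'rV_n, (u <= V)%MS -> (u *m f <= V)%MS) ->
  (forall u : 'rV_n, (u <= V)%MS ->
     u *m f *m f *m f *m f + al *: (u *m f *m f) + be *: u = 0) ->
  let g := restrictmx V f in
  g *m g *m g *m g + al *: (g *m g) + be%:M = 0.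
Proof.
move=> Vf Vp g; set W := row_base V.
have WV i : (row i W <= V)%MS by rewrite (submx_trans (row_sub i W)) ?eq_row_base.
have stW : stablemx W f.
  apply/row_subP => i; rewrite row_mul.
  by rewrite (submx_trans (Vf _ (WV i))) ?eq_row_base.
have gW : g *m W = W *m f by rewrite /g /conjmx mulmxKpV.
have Wfree : row_free W := row_base_free V.
clearbody g W; apply: (row_free_inj Wfree); rewrite mul0mx.
have gWr m (X : 'M[F]_(m, \rank V)) : X *m g *m W = X *m W *m f.
  by rewrite -mulmxA gW mulmxA.
rewrite !mulmxDl -!scalemxAl mul_scalar_mx !gWr gW.
apply/row_matrixP => i; rewrite linear0 !linearD !linearZ /= !row_mul.
exact: Vp.
Qed.

Section Quartic.
Variables (R : rcfType) (al be : R).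
Hypotheses (al0 : 0 < al) (be0 : 0 < be) (disc : 4 * be < al ^+ 2).

Lemma biquadratic_roots : exists s t : R,
  [/\ 0 < s, s < t, s ^+ 2 + t ^+ 2 = al & s ^+ 2 * t ^+ 2 = be].
Proof.
pose d : R := Num.sqrt (al ^+ 2 - 4 * be).
have d2 : d ^+ 2 = al ^+ 2 - 4 * be by rewrite sqr_sqrtr // subr_ge0 ltW.
have d0 : 0 < d by rewrite sqrtr_gt0 subr_gt0.
clearbody d.
have dal : d < al.
  rewrite -(ltr_pXn2r (_ : (0 < 2)%N)) ?nnegrE ?ltW // d2.
  by rewrite ltrBlDr ltrDl mulr_gt0.
have u0 : 0 < (al - d) / 2 by lra.
have v0 : 0 < (al + d) / 2 by lra.
exists (Num.sqrt ((al - d) / 2)), (Num.sqrt ((al + d) / 2)).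
rewrite sqrtr_gt0 u0 !sqr_sqrtr ?ltW // ltr_sqrt //; split => //; try lra.
Qed.

Lemma biquadratic_factor (A : comPzRingType) (i X s t : A) : i ^+ 2 = -1 ->
  (X - i * s) * ((X + i * s) * ((X - i * t) * (X + i * t)))
  = X ^+ 4 + (s ^+ 2 + t ^+ 2) * X ^+ 2 + s ^+ 2 * t ^+ 2.
Proof. by move=> i2; ring: i2. Qed.

Local Notation toC := (real_complex R).

(** As al, be and al^2 - 4 be are positive, X^2 takes two distinct negative
    values - s^2 and - t^2 at the roots. *)
Lemma biquadratic_split : exists rs : seq R[i],
  [/\ uniq rs, (forall z, z \in rs -> complex.Re z = 0) &
   \prod_(z <- rs) ('X - z%:P) = 'X ^+ 4 + (toC al)%:P * 'X ^+ 2 + (toC be)%:P].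
Proof.
have [s [t [s0 st <- <-]]] := biquadratic_roots.
pose im (x : R) : R[i] := Complex 0 x.
have imE x : im x = 'i%C * toC x.
  by apply/eqP; rewrite eq_complex /=; apply/andP; split; apply/eqP; ring.
have imN x : im (- x) = - im x by rewrite !imE rmorphN mulrN.
exists [:: im s; im (- s); im t; im (- t)]; split.
- have im_neq x y : x != y -> im x != im y by rewrite eq_complex /= eqxx.
  by rewrite /= !inE !negb_or !im_neq //; lra.
- by move=> z; rewrite !inE => /or4P[] /eqP->.
rewrite !big_cons big_nil mulr1 !imN !polyCN !opprK !imE !polyCM.
rewrite biquadratic_factor; last by rewrite -polyC_exp sqr_i polyCN.
by rewrite -!polyC_exp -polyCM -polyCD (rmorphD toC)
  (rmorphM toC (s ^+ 2)) !(rmorphXn toC).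
Qed.

Variables (m : nat) (g : 'M[R]_m).
Hypothesis pg : g *m g *m g *m g + al *: (g *m g) + be%:M = 0.
Local Notation gC := (map_mx toC g).

Lemma map_biquadratic :
  gC *m gC *m gC *m gC + toC al *: (gC *m gC) + (toC be)%:M = 0.
Proof.
by rewrite -!map_mxM -map_mxZ -map_scalar_mx -!map_mxD pg map_mx0.
Qed.

Lemma biquadratic_eigenvalue a : eigenvalue gC a -> complex.Re a = 0.
Proof.
case: biquadratic_split => rs [_ Re_rs prodE] /eigenvalueP[v va v0].
apply: Re_rs; rewrite -root_prod_XsubC prodE rootE.
rewrite !(hornerD, hornerM, hornerC, hornerXn).
have : v *m (gC *m gC *m gC *m gC + toC al *: (gC *m gC) + (toC be)%:M) = 0.
  by rewrite map_biquadratic mulmx0.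
rewrite !mulmxDr -scalemxAr mul_mx_scalar !mulmxA.
do 4!rewrite ?va -?scalemxAl; rewrite !scalerA -!scalerDl => /eqP.
rewrite scaler_eq0 (negPf v0) orbF => /eqP <-; apply/eqP.
by rewrite hornerX !mulrA.
Qed.

(** The minimal polynomial divides a product of distinct linear factors. *)
Lemma biquadratic_diagonalizable : diagonalizable gC.
Proof.
have := map_biquadratic; case: m g => [|n] h hp.
  by exists 1%:M; rewrite ?unitmx1 //; apply/is_diag_mxP => -[].
case: biquadratic_split => rs [urs _ prodE].
apply/diagonalizableP; exists rs => //; rewrite prodE.
apply: mxminpoly_min; rewrite !rmorphD !rmorphM /= horner_mx_X !horner_mx_C.
by rewrite -[RHS]hp -mul_scalar_mx !mulmxE !mulrA.
Qed.

End Quartic.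

(** * Differentials of formulas in the coordinates *)

(** Pointwise forms of the differentiation rules, which apply to a formula
    written under a binder. *)
Section PointwiseDiff.
Variables (R : realType) (V : normedModType R).
Implicit Types (f g df dg : V -> R) (x : V).

Lemma is_diff_add f g df dg x : is_diff x f df -> is_diff x g dg ->
  is_diff x (fun y => f y + g y) (fun u => df u + dg u).
Proof. by move=> ? ?; exact: is_diffD. Qed.

Lemma is_diff_opp f df x : is_diff x f df ->
  is_diff x (fun y => - f y) (fun u => - df u).
Proof. by move=> ?; exact: is_diffN. Qed.

Lemma is_diff_mul f g df dg x : is_diff x f df -> is_diff x g dg ->
  is_diff x (fun y => f y * g y) (fun u => f x * dg u + g x * df u).
Proof. by move=> ? ?; exact: is_diffM. Qed.

(** As an instance, it makes the differential of a numeral the explicit function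
    fun=> 0, which the decision procedures can simplify. *)
#[global] Instance is_diff_const (a : R) x : is_diff x (fun=> a) (fun=> 0).
Proof. exact: is_diff_cst. Qed.

Lemma is_diff_inv f df x : f x != 0 -> is_diff x f df ->
  is_diff x (fun y => (f y)^-1) (fun u => - (f x) ^- 2 * df u).
Proof.
move=> fx0 dfx; apply: DiffDef; first exact: differentiableV.
by rewrite diffV // diff_val.
Qed.

Lemma is_diff_sqr f df x : is_diff x f df ->
  is_diff x (fun y => f y ^+ 2) (fun u => 2 * f x * df u).
Proof.
move=> dfx; apply: is_diff_eq (is_diffX 1 dfx) _.
by apply/funext => u; rewrite expr1.
Qed.

Lemma is_diff_real (h dh : R -> R) f df x : is_derive (f x) 1 h (dh (f x)) ->
  is_diff x f df -> is_diff x (fun y => h (f y)) (fun u => dh (f x) * df u).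
Proof.
move=> hd dfx.
have hdiff : differentiable h (f x) by apply/derivable1_diffP; apply: ex_derive.
have ? : is_diff (f x) h ( *:%R^~ (dh (f x))).
  apply: DiffDef => //; rewrite deriv1E; last exact: ex_derive.
  by rewrite derive1E derive_val.
apply: is_diff_eq (is_diff_comp _ _) _.
by apply/funext => u /=; rewrite mulrC.
Qed.

Lemma is_diff_cos f df x : is_diff x f df ->
  is_diff x (fun y => cos (f y)) (fun u => - sin (f x) * df u).
Proof. by move=> ?; exact: (@is_diff_real cos (fun y => - sin y)). Qed.

Lemma is_diff_sin f df x : is_diff x f df ->
  is_diff x (fun y => sin (f y)) (fun u => cos (f x) * df u).
Proof. by move=> ?; exact: (@is_diff_real sin cos). Qed.

Lemma is_diff_sumr (I : finType) (P : pred I) (f df : I -> V -> R) x :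
  (forall i, P i -> is_diff x (f i) (df i)) ->
  is_diff x (fun y => \sum_(i | P i) f i y) (fun u => \sum_(i | P i) df i u).
Proof.
move=> fd.
have -> : (fun y => \sum_(i | P i) f i y) = \sum_(i | P i) f i.
  by apply/funext => y; rewrite fct_sumE.
have -> : (fun u => \sum_(i | P i) df i u) = \sum_(i | P i) df i.
  by apply/funext => y; rewrite fct_sumE.
elim/big_ind2: _ => //; first exact: is_diff_cst.
by move=> ? ? ? ? ? ?; exact: is_diffD.
Qed.

Lemma is_diff_rowP n (f df : V -> 'rV[R]_n) x :
  (forall k, is_diff x (fun y => f y 0 k) (fun u => df u 0 k)) ->
  is_diff x f df.
Proof.
move=> fd.
pose e k : 'rV[R]_n := delta_mx 0 k.
have rowE' (h : V -> 'rV[R]_n) :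
    h = \sum_k (( *:%R^~ (e k)) \o (fun y => h y 0 k)).
  by apply/funext => y; rewrite fct_sumE /= [LHS]row_sum_delta.
rewrite (rowE' f) (rowE' df).
elim/big_ind2: _ => [|? ? ? ? ? ?|k _].
- exact: is_diff_cst.
- exact: is_diffD.
- exact: is_diff_comp.
Qed.

End PointwiseDiff.

(** * The differential of the vortex field *)

Section VectorField.
Variable R : realType.
Implicit Types (s u : 'rV[R]_(3 + 3)) (i j : 'I_3).

Lemma is_diff_coord n k (s : 'rV[R]_n) :
  is_diff s (fun t : 'rV[R]_n => t 0 k) (fun u : 'rV[R]_n => u 0 k).
Proof.
have lin : linear (fun t : 'rV[R]_n => t 0 k) by move=> a u v; rewrite !mxE.
pose L := GRing.isLinear.Build _ _ _ _ _ lin.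
pose f : {linear 'rV[R]_n -> R} := HB.pack (fun t : 'rV[R]_n => t 0 k) L.
apply: DiffDef; first exact: differentiable_coord.
by rewrite (@diff_lin _ _ _ f) //; exact: coord_continuous.
Qed.

Lemma is_diff_radius s i : is_diff s (fun t => radius t i) (fun u => radius u i).
Proof. exact: is_diff_coord. Qed.

Lemma is_diff_angle s i : is_diff s (fun t => angle t i) (fun u => angle u i).
Proof. exact: is_diff_coord. Qed.

Ltac differentiate :=
  repeat match goal with
  | |- is_diff_def _ (fun y => _ + _) _ => apply: is_diff_add
  | |- is_diff_def _ (fun y => _ - _) _ => apply: is_diff_add
  | |- is_diff_def _ (fun y => - _) _ => apply: is_diff_opp
  | |- is_diff_def _ (fun y => _ * _) _ => apply: is_diff_mul
  | |- is_diff_def _ (fun y => _ ^+ 2) _ => apply: is_diff_sqr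
  | |- is_diff_def _ (fun y => _ ^-1) _ => apply: is_diff_inv
  | |- is_diff_def _ (fun y => cos _) _ => apply: is_diff_cos
  | |- is_diff_def _ (fun y => sin _) _ => apply: is_diff_sin
  | |- is_diff_def _ (fun y => radius _ _) _ => exact: is_diff_radius
  | |- is_diff_def _ (fun y => angle _ _) _ => exact: is_diff_angle
  | |- is_diff_def _ (fun y => _) _ => exact: is_diff_const
  end.

(** The differentials take a rational form in the logarithmic variations
    dlog s u i = dr_i / r_i, the variations of the angles, and the real and
    imaginary parts [inner] and [cross] of Z_i conj(Z_j). *)
Definition dangle s i j := angle s i - angle s j.
Definition dlog s u i := radius u i / radius s i.
Definition inner s i j := radius s i * radius s j * cos (dangle s i j).
Definition cross s i j := radius s i * radius s j * sin (dangle s i j).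

Definition dsqdist s i j u : R :=
  2 * radius s i ^+ 2 * dlog s u i + 2 * radius s j ^+ 2 * dlog s u j
  - 2 * (inner s i j * (dlog s u i + dlog s u j) - cross s i j * dangle u i j).

Lemma is_diff_sqdist s i j : radius s i != 0 -> radius s j != 0 ->
  is_diff s (fun t => sqdist t i j) (dsqdist s i j).
Proof.
move=> ri rj; apply: is_diff_eq; first by rewrite /sqdist; differentiate.
apply/funext => u; rewrite /dsqdist /inner /cross /dlog /dangle /=; field.
by rewrite ri rj.
Qed.

(** The contributions of vortex j, per unit of circulation, to dr_i/dt and to
    dtheta_i/dt. *)
Definition radial_term s i j : R :=
  radius s j * sin (dangle s i j) * (1 / radius s j ^+ 2 - 1 / sqdist s i j).

Definition dradial_term s i j u : R :=
  (radius s i)^-1 *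
  ((cross s i j * dlog s u j + inner s i j * dangle u i j)
     * (1 / radius s j ^+ 2 - 1 / sqdist s i j)
   + cross s i j * (dsqdist s i j u / sqdist s i j ^+ 2
                    - 2 * dlog s u j / radius s j ^+ 2)).

Definition angular_term s i j : R :=
  (radius s i ^+ 2 * radius s j * cos (dangle s i j)
     - radius s i * radius s j ^+ 2 * cos (2 * dangle s i j))
  / (radius s i * radius s j ^+ 2 * sqdist s i j).

Definition dangular_term s i j u : R :=
  ((inner s i j * (dlog s u i - dlog s u j) - cross s i j * dangle u i j)
      / radius s j ^+ 2
   + 4 * cross s i j * inner s i j * dangle u i j
      / (radius s i ^+ 2 * radius s j ^+ 2)) / sqdist s i j
  - (inner s i j / radius s j ^+ 2
     - 2 * inner s i j ^+ 2 / (radius s i ^+ 2 * radius s j ^+ 2) + 1)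
    * (dsqdist s i j u / sqdist s i j ^+ 2).

Section Terms.
Variables (s : 'rV[R]_(3 + 3)) (i j : 'I_3).
Hypotheses (ri : radius s i != 0) (rj : radius s j != 0).
Hypothesis (dij : sqdist s i j != 0).

Lemma is_diff_radial_term :
  is_diff s (fun t => radial_term t i j) (dradial_term s i j).
Proof.
apply: is_diff_eq.
  rewrite /radial_term /dangle; differentiate; rewrite ?expf_eq0 //.
  exact: is_diff_sqdist.
apply/funext => u.
rewrite /dradial_term /inner /cross -/(dangle s i j) -/(dangle u i j) /dlog.
by field; rewrite ri rj dij.
Qed.

Lemma is_diff_angular_term :
  is_diff s (fun t => angular_term t i j) (dangular_term s i j).
Proof.
apply: is_diff_eq.
  rewrite /angular_term /dangle; differentiate;
    rewrite ?mulf_neq0 ?expf_eq0 //; exact: is_diff_sqdist.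
apply/funext => u.
rewrite /dangular_term /inner /cross -/(dangle s i j) -/(dangle u i j) /dlog.
have -> : 2 * dangle s i j = dangle s i j *+ 2 by rewrite mulr_natl.
rewrite cos_mulr2n sin_mulr2n /=.
generalize dependent (sqdist s i j) => d d0.
generalize dependent (radius s i) => p p0.
generalize dependent (radius s j) => q q0.
move: (cos _) (sin _) (dangle u i j) (radius u i) (radius u j) (dsqdist s i j u).
move=> c sn w up uq ud.
by field; rewrite p0 q0 d0.
Qed.

End Terms.

Section Field.
Variables (eps : R) (mu : 'I_3 -> R) (s : 'rV[R]_(3 + 3)).
Hypothesis s_radius : forall i, radius s i != 0.
Hypothesis s_dist : forall i j, i != j -> sqdist s i j != 0.

Definition dvortex_field u : 'rV[R]_(3 + 3) :=
  row_mx
    (\row_i (eps * \sum_(j | j != i) mu j * dradial_term s i j u))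
    (\row_i (- 2 * (1 + eps * mu i) / radius s i ^+ 2 * dlog s u i
      + eps * \sum_(j | j != i) mu j * dangular_term s i j u)).

Lemma is_diff_vortex_field :
  is_diff s (vortex_field eps mu) dvortex_field.
Proof.
apply: is_diff_rowP => k; case: (split_ordP k) => i ->.
  under eq_fun do rewrite /vortex_field row_mxEl mxE /rdot.
  under [X in is_diff_def _ _ X]eq_fun do
    rewrite /dvortex_field row_mxEl mxE.
  have -> : (fun t => eps * (\sum_(j | j != i) mu j * radius t j *
       sin (angle t i - angle t j) * (1 / radius t j ^+ 2 - 1 / sqdist t i j))) =
     (fun t => eps * (\sum_(j | j != i) mu j * radial_term t i j)).
    by apply/funext => t; congr (_ * _); apply: eq_bigr => j _; rewrite !mulrA.
  apply: is_diff_eq.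
    apply: is_diff_mul; apply: is_diff_sumr => j ji.
    apply: is_diff_mul; apply: is_diff_radial_term => //.
    by rewrite s_dist // eq_sym.
  apply/funext => u /=; rewrite mulr0 addr0; congr (_ * _).
  by apply: eq_bigr => j _; rewrite mulr0 addr0.
under eq_fun do rewrite /vortex_field row_mxEr mxE /thetadot.
under [X in is_diff_def _ _ X]eq_fun do
  rewrite /dvortex_field row_mxEr mxE.
apply: is_diff_eq.
  apply: is_diff_add.
    differentiate; rewrite ?expf_eq0 //; exact: s_radius.
  apply: is_diff_mul; apply: is_diff_sumr => j ji.
  apply: is_diff_mul; apply: is_diff_angular_term => //.
  by rewrite s_dist // eq_sym.
apply/funext => u /=; congr (_ + _).
  by rewrite /dlog; field; exact: s_radius.
rewrite mulr0 addr0; congr (_ * _).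
by apply: eq_bigr => j _; rewrite mulr0 addr0.
Qed.

End Field.

Definition dcartesian s u : 'rV[R]_(3 + 3) :=
  row_mx (\row_i (radius s i * cos (angle s i) * dlog s u i
                  - radius s i * sin (angle s i) * angle u i))
         (\row_i (radius s i * sin (angle s i) * dlog s u i
                  + radius s i * cos (angle s i) * angle u i)).

Lemma is_diff_cartesian s : (forall i, radius s i != 0) ->
  is_diff s (@cartesian R) (dcartesian s).
Proof.
move=> r0; apply: is_diff_rowP => k; case: (split_ordP k) => i ->.
  under eq_fun do rewrite /cartesian row_mxEl mxE.
  under [X in is_diff_def _ _ X]eq_fun do
    rewrite /dcartesian row_mxEl mxE.
  apply: is_diff_eq; first by differentiate.
  by apply/funext => u /=; rewrite /dlog; field; exact: r0.
under eq_fun do rewrite /cartesian row_mxEr mxE.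
under [X in is_diff_def _ _ X]eq_fun do
    rewrite /dcartesian row_mxEr mxE.
apply: is_diff_eq; first by differentiate.
by apply/funext => u /=; rewrite /dlog; field; exact: r0.
Qed.

(** * The symplectic form and a criterion for linear stability *)

Section Symplectic.
Variables (eps : R) (mu : 'I_3 -> R) (s : 'rV[R]_(3 + 3)).

Lemma Omega_linear_r u : linear (Omega eps mu u : _ -> R^o).
Proof.
move=> a v w; rewrite /Omega /wedge /dX /dY; move: (_^-1) => GT.
rewrite !big_ord_recl !big_ord0 !mxE -[a *: _]/(a * _); ring.
Qed.

Lemma Omega_linear_l v : linear (Omega eps mu ^~ v : _ -> R^o).
Proof.
move=> a u w; rewrite /Omega /wedge /dX /dY; move: (_^-1) => GT.
rewrite !big_ord_recl !big_ord0 !mxE -[a *: _]/(a * _); ring.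
Qed.

Let linear_comb (V : lmodType R) (f : V -> R^o) n
    (c : 'I_n -> R) (v : 'I_n -> V) :
  linear f -> f (\sum_i c i *: v i) = \sum_i c i * f (v i).
Proof.
move=> lf; pose L := GRing.isLinear.Build _ _ _ _ _ lf.
pose g : {linear V -> R^o} := HB.pack f L.
rewrite -[f]/(g : V -> R^o) linear_sum.
by apply: eq_bigr => i _; rewrite linearZ.
Qed.

Lemma Omega_polarE u v :
  (u *m Omega_polar eps mu s *m v^T) 0 0 =
  Omega eps mu ('d (@cartesian R) s u) ('d (@cartesian R) s v).
Proof.
have sumE (w : 'rV[R]_(3 + 3)) : 'd (@cartesian R) s w =
    \sum_i w 0 i *: 'd (@cartesian R) s (delta_mx 0 i).
  rewrite {1}[w]row_sum_delta linear_sum; apply: eq_bigr => i _.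
  by rewrite linearZ.
rewrite (sumE u) (sumE v) (linear_comb _ _ (Omega_linear_l _)) mxE.
under eq_bigr do rewrite !mxE big_distrl /=.
rewrite exchange_big /=; apply: eq_bigr => i _.
rewrite (linear_comb _ _ (Omega_linear_r _)) big_distrr /=; apply: eq_bigr => j _.
by rewrite !mxE; ring.
Qed.

End Symplectic.
End VectorField.

Section Criterion.
Variable R : realType.
Variables (eps : R) (mu : 'I_3 -> R) (s : 'rV[R]_(3 + 3)).
Hypothesis s_radius : forall i, radius s i != 0.
Hypothesis s_dist : forall i j, i != j -> sqdist s i j != 0.

Definition rotation_dir : 'rV[R]_(3 + 3) := row_mx 0 (const_mx 1).
Definition scaling_dir : 'rV[R]_(3 + 3) := row_mx (\row_i radius s i) 0.
(** For v = rotation_dir this is, up to the factor - 1/2, the variation along u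
    of the moment of inertia about the center of vorticity. *)
Definition moment (v u : 'rV[R]_(3 + 3)) : R :=
  Omega eps mu (dcartesian s u) (dcartesian s v).

Lemma skew_orthogonalP u :
  reflect (moment rotation_dir u = 0 /\ moment scaling_dir u = 0)
    (u <= skew_orthogonal eps mu s)%MS.
Proof.
have momE v : u *m Omega_polar eps mu s *m v^T = (moment v u)%:M.
  rewrite [LHS]mx11_scalar Omega_polarE /moment.
  by have [_ ->] := is_diff_cartesian s_radius.
rewrite /skew_orthogonal sub_kermx /symmetry_space tr_col_mx mulmxA.
rewrite mul_mx_row -/rotation_dir -/scaling_dir !momE.
apply: (iffP eqP) => [|[-> ->]]; last by rewrite raddf0 row_mx0.
rewrite -(@row_mx0 _ 1 1 1) => /eq_row_mx[/matrixP/(_ 0 0) + /matrixP/(_ 0 0)].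
by rewrite !mxE eqxx.
Qed.

Lemma mul_jacobian u :
  u *m jacobian (vortex_field eps mu) s = dvortex_field eps mu s u.
Proof.
rewrite /jacobian mul_rV_lin1 /=.
by have [_ ->] := is_diff_vortex_field eps mu s_radius s_dist.
Qed.

(** The differential T of the field replaces the jacobian and two linear
    equations replace the skew-orthogonal complement, so that only identities
    between coordinates of tangent vectors remain to be checked.  The conditions
    on al and be give X^4 + al X^2 + be four distinct imaginary roots. *)
Lemma linearly_stableP (al be : R) (q : 'I_4 -> 'rV[R]_2) :
  0 < al -> 0 < be -> 4 * be < al ^+ 2 ->
  polar_of q s -> vortex_field eps mu s = 0 ->
  (forall u, let T := dvortex_field eps mu s in
     moment rotation_dir u = 0 -> moment scaling_dir u = 0 ->
     [/\ moment rotation_dir (T u) = 0, moment scaling_dir (T u) = 0 &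
         T (T (T (T u))) + al *: T (T u) + be *: u = 0]) ->
  linearly_stable eps mu q.
Proof.
move=> al0 be0 disc qs fixed Tprop; exists s.
have quartic : let g := restrictmx (skew_orthogonal eps mu s)
      (jacobian (vortex_field eps mu) s) in
    g *m g *m g *m g + al *: (g *m g) + be%:M = 0.
  apply: restrictmx_quartic => u /skew_orthogonalP[u1 u2]; have [] := Tprop u u1 u2.
    by move=> ? ? _; rewrite mul_jacobian; apply/skew_orthogonalP.
  by move=> _ _; rewrite !mul_jacobian.
split=> //.
- by move=> a; apply: biquadratic_eigenvalue quartic _.
- by apply: biquadratic_diagonalizable quartic.
Qed.

End Criterion.

(** * Reflections and polar coordinates *)

Section Plane.
Variable R : realType.
Implicit Types (u v x y a n : 'rV[R]_2).

Lemma dotE u v : dot u v = u 0 0 * v 0 0 + u 0 1 * v 0 1.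
Proof.
rewrite /dot !big_ord_recl big_ord0 addr0.
by rewrite (_ : lift ord0 ord0 = 1) //; apply: val_inj.
Qed.

Lemma dot_gt0 n : n != 0 -> 0 < dot n n.
Proof.
move=> n0; rewrite dotE -!expr2 lt0r addr_ge0 ?sqr_ge0 // andbT.
apply: contra n0; rewrite paddr_eq0 ?sqr_ge0 // !sqrf_eq0.
move=> /andP[/eqP n00 /eqP n01].
by apply/eqP/rowP => k; rewrite mxE; case: k => -[|[|//]] lk;
  [rewrite -n00 | rewrite -n01]; congr (n _ _); apply: val_inj.
Qed.

Lemma reflection_isometry a n x y : n != 0 ->
  dot (reflection a n x - reflection a n y) (reflection a n x - reflection a n y)
  = dot (x - y) (x - y).
Proof.
move=> /dot_gt0/lt0r_neq0; rewrite /reflection !dotE !mxE => n0.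
by field.
Qed.

Lemma reflection_fixed a n x : n != 0 -> reflection a n x = x -> dot (x - a) n = 0.
Proof.
move=> n0 /eqP; rewrite /reflection -subr_eq0 addrAC subrr add0r oppr_eq0.
rewrite scaler_eq0 (negPf n0) orbF mulf_eq0 invr_eq0.
by rewrite (negPf (lt0r_neq0 (dot_gt0 n0))) orbF mulf_eq0 pnatr_eq0 => /eqP.
Qed.

Lemma polar_coordinates (x y : R) : (x != 0) || (y != 0) ->
  exists r theta, [/\ 0 < r, x = r * cos theta & y = r * sin theta].
Proof.
move=> xy0; pose r := Num.sqrt (x ^+ 2 + y ^+ 2).
have r2 : r ^+ 2 = x ^+ 2 + y ^+ 2 by rewrite sqr_sqrtr // addr_ge0 ?sqr_ge0.
have r0 : 0 < r.
  rewrite sqrtr_gt0 lt0r addr_ge0 ?sqr_ge0 // andbT.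
  by rewrite paddr_eq0 ?sqr_ge0 // !sqrf_eq0 negb_and.
have xr : -1 <= x / r <= 1.
  rewrite -ler_norml normrM normfV (gtr0_norm r0) ler_pdivrMr // mul1r.
  rewrite -ler_sqr ?nnegrE ?(ltW r0) // r2 real_normK ?num_real //.
  by rewrite lerDl sqr_ge0.
have cosE : x = r * cos (acos (x / r)).
  by rewrite acosK ?in_itv //= mulrC divfK ?lt0r_neq0.
have sinE : `|y| = r * sin (acos (x / r)).
  rewrite sin_acos // -{1}(gtr0_norm r0) -[`|r|]sqrtr_sqr -sqrtrM ?sqr_ge0 //.
  rewrite -sqrtr_sqr; congr Num.sqrt; rewrite exprMn mulrBr mulr1 mulrCA.
  rewrite exprVn mulfV ?expf_eq0 ?lt0r_neq0 //.
  by rewrite mulr1 r2 addrAC subrr add0r.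
case: (lerP 0 y) => [y0|/ltW y0].
  by exists r, (acos (x / r)); rewrite -cosE -sinE ger0_norm.
exists r, (- acos (x / r)).
by rewrite cosN sinN mulrN -cosE -sinE ler0_norm // opprK.
Qed.

End Plane.

(** * Three and four vortices by cases *)

Local Notation i0 := (ord0 : 'I_3).
Local Notation i1 := (lift ord0 ord0 : 'I_3).
Local Notation i2 := (lift ord0 (lift ord0 ord0) : 'I_3).
Local Notation v0 := (ord0 : 'I_4).
Local Notation v1 := (lift ord0 i0 : 'I_4).
Local Notation v2 := (lift ord0 i1 : 'I_4).
Local Notation v3 := (lift ord0 i2 : 'I_4).

Lemma ord4P (P : 'I_4 -> Prop) : P v0 -> P v1 -> P v2 -> P v3 -> forall i, P i.
Proof.
by move=> P0 P1 P2 P3 [[|[|[|[|//]]]] lti];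
  [move: P0 | move: P1 | move: P2 | move: P3]; congr P; apply: val_inj.
Qed.

Lemma ord3P (P : 'I_3 -> Prop) : P i0 -> P i1 -> P i2 -> forall i, P i.
Proof.
by move=> P0 P1 P2 [[|[|[|//]]] lti];
  [move: P0 | move: P1 | move: P2]; congr P; apply: val_inj.
Qed.

Section Triple.
Variable T : Type.
Definition triple (x y z : T) (i : 'I_3) : T := nth z [:: x; y] i.
Lemma tripleE x y z : (triple x y z i0 = x) * (triple x y z i1 = y)
  * (triple x y z i2 = z).
Proof. by []. Qed.
End Triple.

Section Sums.
Variables (V : nmodType) (F : 'I_3 -> V).

Lemma sum3 : \sum_i F i = F i0 + F i1 + F i2.
Proof. by rewrite !big_ord_recl big_ord0 /= addr0 addrA. Qed.

Lemma sum3_neq0 : \sum_(j | j != i0) F j = F i1 + F i2.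
Proof. by rewrite big_mkcond !big_ord_recl big_ord0 /= !addr0 ?add0r. Qed.

Lemma sum3_neq1 : \sum_(j | j != i1) F j = F i0 + F i2.
Proof. by rewrite big_mkcond !big_ord_recl big_ord0 /= !addr0 ?add0r. Qed.

Lemma sum3_neq2 : \sum_(j | j != i2) F j = F i0 + F i1.
Proof. by rewrite big_mkcond !big_ord_recl big_ord0 /= !addr0 ?add0r. Qed.

End Sums.

(** * The configuration *)

Section Configuration.
Variable R : realType.

(** Positions relative to vortex 0 in the basis (a, 0), (0, a w / 3); there,
    squared distances are multiples of 3 dx^2 + 13 dy^2. *)
Definition xs : 'I_3 -> R := triple 7 0 8.
Definition ys : 'I_3 -> R := triple 3 4 0.
Definition strength : 'I_3 -> R := triple 44 65 35.

(** With this parameter the circulations 1, eps0 * strength are in the ratio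
    143 : 44 : 65 : 35. *)
Definition eps0 : R := 1 / 143.

Definition heliocentric (f : 'I_3 -> R) (i : 'I_4) : R := oapp f 0 (unlift ord0 i).
Definition px := heliocentric xs.
Definition py := heliocentric ys.

Lemma pxE : (px v0 = 0) * (px v1 = 7) * (px v2 = 0) * (px v3 = 8).
Proof. by rewrite /px /heliocentric unlift_none !liftK. Qed.

Lemma pyE : (py v0 = 0) * (py v1 = 3) * (py v2 = 4) * (py v3 = 0).
Proof. by rewrite /py /heliocentric unlift_none !liftK. Qed.

Local Notation Gam := (circulation eps0 strength).

Lemma GamE : (Gam v0 = 1) * (Gam v1 = 4 / 13) * (Gam v2 = 5 / 11)
  * (Gam v3 = 35 / 143).
Proof.
rewrite /circulation unlift_none !liftK /strength !tripleE /eps0.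
by do 3?split; field.
Qed.

Variables w a : R.
Hypotheses (w2 : w ^+ 2 = 39) (w0 : 0 < w).
Hypotheses (a2 : a ^+ 2 = 123 / 4576) (a0 : 0 < a).

(** The center of vorticity of the points (px i, py i) is (84 / 41, 56 / 41),
    and the value of a^2 normalizes the rotation rate to 1. *)
Definition config (i : 'I_4) : 'rV[R]_2 :=
  \row_k (if k == 0 then a * (px i - 84 / 41)
           else a * (w / 3) * (py i - 56 / 41)).

Definition sep (i j : 'I_4) : nat :=
  nth 0%N (nth [::] [:: [:: 0; 33; 26; 24]; [:: 33; 0; 20; 15];
                      [:: 26; 20; 0; 50]; [:: 24; 15; 50; 0]] i) j.

Lemma dist_config i j :
  dot (config i - config j) (config i - config j) = 41 / 572 * (sep i j)%:R.
Proof.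
rewrite dotE !mxE /=.
transitivity (a ^+ 2 * ((px i - px j) ^+ 2 + w ^+ 2 / 9 * (py i - py j) ^+ 2)).
  by field.
rewrite a2 w2; move: i; apply: ord4P; move: j; apply: ord4P;
by rewrite !pxE !pyE /sep /=; field.
Qed.

Lemma config_relative_equilibrium : relative_equilibrium Gam 1 config.
Proof.
have c0 : 41 / 572 != 0 :> R by rewrite mulf_eq0 invr_eq0 !pnatr_eq0.
split.
- move=> i j ij; have := dist_config i j; rewrite ij subrr dotE !mxE !mulr0 addr0.
  move=> /esym/eqP; rewrite mulf_eq0 pnatr_eq0 (negPf c0) /=.
  by move: i {ij}; apply: ord4P; move: j; apply: ord4P.
- rewrite !big_ord_recl big_ord0 !GamE addr0; apply/rowP => k; rewrite !mxE.
  by case: ifP => _; rewrite ?pxE ?pyE; field.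
- apply: ord4P; rewrite big_mkcond !big_ord_recl big_ord0 /= !dist_config /sep /=;
  rewrite !GamE; apply/rowP => k; rewrite !mxE;
  by case: ifP => _; rewrite /= ?pxE ?pyE; field.
Qed.

(** The six values of sep at distinct indices differ, so k preserves each pair
    of indices, and a single index is determined by the pairs containing it. *)
Lemma sep_rigid (k : 'I_4 -> 'I_4) :
  (forall i j, sep (k i) (k j) = sep i j) -> k =1 id.
Proof.
move=> kE.
suff [e0 e1 e2 e3] : [/\ k v0 = v0 :> nat, k v1 = v1 :> nat,
    k v2 = v2 :> nat & k v3 = v3 :> nat].
  by apply: ord4P; apply: val_inj.
(* The longest side leaves two choices for k v2 and k v3; the sides from v0
   exclude the transposition. *)
move: (kE v2 v3) (kE v0 v2) (kE v0 v3) (kE v1 v2) (kE v1 v3).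
case: (k v2) => -[|[|[|[|//]]]] ?; case: (k v3) => -[|[|[|[|//]]]] ? //= _;
  case: (k v0) => -[|[|[|[|//]]]] ? //= _ _;
  by case: (k v1) => -[|[|[|[|//]]]] ?.
Qed.

Lemma config_asymmetric : ~ has_line_of_symmetry config.
Proof.
case=> c [n [n0 symm]].
have /choice[k kE] : forall i, exists j, reflection c n (config i) = config j.
  move=> i.
  have : (reflection c n @` range config)%classic (reflection c n (config i)).
    by exists (config i) => //; exists i.
  by rewrite symm => -[j _ <-]; exists j.
have kid : k =1 id.
  apply: sep_rigid => i j; apply/eqP; rewrite -(eqr_nat R); apply/eqP.
  apply: (@mulfI _ (41 / 572)); first by rewrite mulf_eq0 invr_eq0 !pnatr_eq0.
  by rewrite -!dist_config -!kE reflection_isometry.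
have fixed i : dot (config i - c) n = 0.
  by apply: reflection_fixed; rewrite // kE kid.
(* v2 - v0 and v3 - v0 are along the axes, so both coordinates of n vanish. *)
have := (fixed v0, fixed v2, fixed v3).
rewrite !dotE !mxE /= !pxE !pyE => -[[e0 e2] e3].
have n00 : n 0 0 = 0.
  have : 8 * a * n 0 0 = 0 by lra.
  by move/eqP; rewrite !mulf_eq0 (gt_eqF a0) orbF => /orP[/eqP|/eqP //]; lra.
have n01 : n 0 1 = 0.
  have : 4 * a * w / 3 * n 0 1 = 0 by lra.
  move/eqP; rewrite !mulf_eq0 (gt_eqF a0) (gt_eqF w0) !orbF => /orP[|/eqP //].
  by move=> /orP[] /eqP; lra.
have := dot_gt0 n0; rewrite dotE n00 n01; lra.
Qed.

End Configuration.

(** * The linearization in complex logarithmic coordinates *)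

(** Real vectors f and t stand for the real and imaginary parts of zeta.  The
    forms give K = (w A + i B) / 41 - i, the matrix of the linearization
    zeta |-> - i zeta + K conj(zeta), and W = (P - i w Q) / (11 * 41^2), its
    square.  Large numerators and denominators are split or factored. *)
Section SecondIterate.
Variable R : realFieldType.
Implicit Types f t g h : 'I_3 -> R.

Definition formA f : 'I_3 -> R := triple
  (- 133 / (24 * 11) * f i0 + 7 * 97 / (4 * 110) * f i1 - 7 ^+ 3 / (3 * 110) * f i2)
  (- 91 / (3 * 100) * f i0 + 7 * 87 / (4 * 125) * f i1 - 7 ^+ 3 / (3 * 125) * f i2)
  (- 16 / 75 * f i0 + 204 / 125 * f i1 - 4 * 133 / (3 * 125) * f i2).

Definition formB f : 'I_3 -> R := triple
  (3 * (8 * 10 ^+ 2 + 23) / 88 * f i0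
     - 13 * (6 * 10 ^+ 2 - 23) / (4 * 110) * f i1 - 7 * 173 / 110 * f i2)
  (- 23 * 59 / 100 * f i0 + 11 * (7 * 10 ^+ 2 + 39) / (4 * 125) * f i1
     - 4 * 84 / 125 * f i2)
  (- 4 * 108 / 25 * f i0 - 26 ^+ 2 / 125 * f i1
     + 4 * (7 * 10 ^+ 2 + 9) / 125 * f i2).

Definition formP f : 'I_3 -> R := triple
  (- (12 * 10 ^+ 4 + 77) / 10 * f i0 + 117 * (32 * 10 ^+ 2 - 9) / 50 * f i1
     + (11 * 10 ^+ 4 + 35 * 10 ^+ 2 + 19) / 25 * f i2)
  ((15 * 10 ^+ 5 + 317 * 10 ^+ 2 + 43) / 250 * f i0
     - 3 * 17 * 23 * (2 * 10 ^+ 3 - 27) / 250 * f i1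
     + 63 * (62 * 10 ^+ 2 + 11) / 125 * f i2)
  ((84 * 10 ^+ 4 - 32 ^+ 2) / 125 * f i0 + (69 * 10 ^+ 4 - 12) / 125 * f i1
     - (15 * 10 ^+ 5 + 289 * 10 ^+ 2 + 64) / 125 * f i2).

Definition formQ f : 'I_3 -> R := triple
  (- 231 / 2 * f i0 + 7 * (27 * 10 ^+ 2 + 29) / 50 * f i1 - 8 * 833 / 25 * f i2)
  (- 7 * 43 * 107 / 250 * f i0 + 7 * 557 / 10 * f i1 - 18 * 49 * 37 / 125 * f i2)
  (- 256 * 49 / 125 * f i0 + 4 * 49 * 239 / 125 * f i1 - 4 * 343 / 5 * f i2).

(** Real and imaginary parts of
    h(zeta) = sum_k Gamma_k Z_k conj(Z_k - Z_c) zeta_k times 286 * 143, where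
    Z_c is the heliocentric position of the center of vorticity. *)
Definition moment_re (w : R) f t : R :=
  99 * 191 * f i0 + 135 * 169 * f i1 + 30 * 427 * f i2
  - 35 * w * (11 * t i0 - 39 * t i1 + 28 * t i2).

Definition moment_im (w : R) f t : R :=
  99 * 191 * t i0 + 135 * 169 * t i1 + 30 * 427 * t i2
  + 35 * w * (11 * f i0 - 39 * f i1 + 28 * f i2).

(** W kills (1, 1, 1); its characteristic polynomial is
    X (X^2 + trace_coef X + minor_coef). *)
Definition trace_coef : R := (33 * 10 ^+ 3 + 496 + 91 / 125) / (11 * 41 ^+ 2).
Definition minor_coef : R := 8 * 3 * 61 * 71 * 149 * (10 ^+ 3 + 19) / (625 * 11 * 41 ^+ 4).

Variable w : R.
Hypothesis w2 : w ^+ 2 = 39.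

Section OneStep.
Variables (f t f' t' : 'I_3 -> R).
Hypothesis f'E : forall i, f' i = (w * formA f i + formB t i) / 41.
Hypothesis t'E : forall i, t' i = (formB f i - w * formA t i) / 41 - 2 * f i.

(** The antilinear part cancels: - i (K conj(zeta)) + K conj(- i zeta) = 0. *)
Lemma second_iterate i :
  (w * formA f' i + formB t' i) / 41
    = (formP f i + w * formQ t i) / (11 * 41 ^+ 2) /\
  (formB f' i - w * formA t' i) / 41 - 2 * f' i
    = (formP t i - w * formQ f i) / (11 * 41 ^+ 2).
Proof.
move: (f'E i0) (f'E i1) (f'E i2) (t'E i0) (t'E i1) (t'E i2).
rewrite /formA /formB !tripleE => f0E f1E f2E t0E t1E t2E.
by move: i; apply: ord3P; rewrite !tripleE f0E f1E f2E t0E t1E t2E;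
  rewrite /formP /formQ !tripleE; split; field: w2.
Qed.

(** h pairs zeta with the symmetry directions.  The linearization preserves the
    symplectic form, kills the rotation and sends the scaling to - 2 times the
    rotation, whence the two identities. *)
Lemma moment_step :
  moment_re w f' t' = 0 /\ moment_im w f' t' = - 2 * moment_re w f t.
Proof.
rewrite /moment_re /moment_im !f'E !t'E /formA /formB !tripleE.
by split; field: w2.
Qed.

End OneStep.

Section TwoSteps.
Variables (f t g h : 'I_3 -> R).
Hypothesis gE : forall i, g i = (formP f i + w * formQ t i) / (11 * 41 ^+ 2).
Hypothesis hE : forall i, h i = (formP t i - w * formQ f i) / (11 * 41 ^+ 2).
Let c : R := 4 * 71 * (10 ^+ 3 + 19) / (625 * 11 * 41 ^+ 4).

(** W^2 + trace_coef W + minor_coef annihilates the kernel of h and has image in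
    the line spanned by (1, 1, 1), the kernel of W; so it is h up to a
    constant, in every coordinate. *)
Lemma fourth_iterate i :
  (formP g i + w * formQ h i) / (11 * 41 ^+ 2)
    + trace_coef * g i + minor_coef * f i = c * moment_re w f t /\
  (formP h i - w * formQ g i) / (11 * 41 ^+ 2)
    + trace_coef * h i + minor_coef * t i = c * moment_im w f t.
Proof.
move: (gE i0) (gE i1) (gE i2) (hE i0) (hE i1) (hE i2).
rewrite /formP /formQ /moment_re /moment_im /trace_coef /minor_coef /c !tripleE.
move=> g0E g1E g2E h0E h1E h2E.
by move: i; apply: ord3P; rewrite !tripleE g0E g1E g2E h0E h1E h2E;
  split; field: w2.
Qed.

End TwoSteps.
End SecondIterate.

(** * Stability of the configuration *)

Section Stability.
Variable R : realType.
Variables (w a : R) (s : 'rV[R]_(3 + 3)).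
Hypothesis w2 : w ^+ 2 = 39.
Hypothesis a2 : a ^+ 2 = 123 / 4576.
Hypothesis s_gt0 : forall i, 0 < radius s i.
Hypothesis s_cos : forall i, radius s i * cos (angle s i) = a * xs R i.
Hypothesis s_sin : forall i, radius s i * sin (angle s i) = a * (w / 3) * ys R i.

Lemma innerE i j :
  inner s i j = 41 / 4576 * (3 * xs R i * xs R j + 13 * ys R i * ys R j).
Proof.
rewrite /inner /dangle cosB.
transitivity ((radius s i * cos (angle s i)) * (radius s j * cos (angle s j)) +
  (radius s i * sin (angle s i)) * (radius s j * sin (angle s j))); first by ring.
rewrite !s_cos !s_sin.
transitivity (a ^+ 2 * (xs R i * xs R j + w ^+ 2 / 9 * (ys R i * ys R j))).
  by field.
by rewrite a2 w2; field.
Qed.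

Lemma crossE i j :
  cross s i j = 41 / 4576 * w * (ys R i * xs R j - xs R i * ys R j).
Proof.
rewrite /cross /dangle sinB.
transitivity ((radius s i * sin (angle s i)) * (radius s j * cos (angle s j)) -
  (radius s i * cos (angle s i)) * (radius s j * sin (angle s j))); first by ring.
rewrite !s_cos !s_sin.
transitivity (a ^+ 2 * (w / 3 * (ys R i * xs R j - xs R i * ys R j))).
  by field.
by rewrite a2; field.
Qed.

Lemma sqr_radiusE i : radius s i ^+ 2 = inner s i i.
Proof. by rewrite /inner /dangle subrr cos0 mulr1 expr2. Qed.

Lemma sqdistE i j :
  sqdist s i j = radius s i ^+ 2 + radius s j ^+ 2 - 2 * inner s i j.
Proof. by rewrite /sqdist /inner !mulrA. Qed.

Lemma innerC i j : inner s i j = inner s j i.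
Proof. by rewrite !innerE; ring. Qed.

Lemma crossC i j : cross s i j = - cross s j i.
Proof. by rewrite !crossE; ring. Qed.

Lemma sqdistC i j : sqdist s i j = sqdist s j i.
Proof. by rewrite !sqdistE innerC (addrC (_ ^+ 2)). Qed.

Lemma radius_valE : (radius s i0 ^+ 2 = 123 / 52)
  * (radius s i1 ^+ 2 = 41 / 22) * (radius s i2 ^+ 2 = 246 / 143).
Proof.
by rewrite !sqr_radiusE !innerE /xs /ys !tripleE; (split; first split); field.
Qed.

Lemma inner_valE : (inner s i0 i1 = 123 / 88) * (inner s i0 i2 = 861 / 572)
  * (inner s i1 i2 = 0).
Proof. by rewrite !innerE /xs /ys !tripleE; (split; first split); field. Qed.

Lemma cross_valE : (cross s i0 i1 = - 287 / 1144 * w)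
  * (cross s i0 i2 = 123 / 572 * w) * (cross s i1 i2 = 41 / 143 * w).
Proof. by rewrite !crossE /xs /ys !tripleE; (split; first split); field. Qed.

Lemma sqdist_valE : (sqdist s i0 i1 = 205 / 143)
  * (sqdist s i0 i2 = 615 / 572) * (sqdist s i1 i2 = 1025 / 286).
Proof.
by rewrite !sqdistE !radius_valE !inner_valE; (split; first split); field.
Qed.

Definition geometryE := (radius_valE, inner_valE, cross_valE, sqdist_valE,
  (innerC i1 i0, innerC i2 i0, innerC i2 i1),
  (crossC i1 i0, crossC i2 i0, crossC i2 i1),
  (sqdistC i1 i0, sqdistC i2 i0, sqdistC i2 i1)).

Lemma radius_neq0 i : radius s i != 0.
Proof. exact: lt0r_neq0. Qed.

Lemma sqdist_neq0 i j : i != j -> sqdist s i j != 0.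
Proof.
move: i; apply: ord3P; move: j; apply: ord3P; rewrite ?eqxx //= => _;
  by rewrite !geometryE ?mulf_neq0 ?invr_eq0 ?pnatr_eq0.
Qed.

Local Notation eps := (eps0 R).
Local Notation mu := (@strength R).
Local Notation T := (dvortex_field eps mu s).

Lemma radius_radial_term i j : radius s i * radial_term s i j =
  cross s i j * (1 / radius s j ^+ 2 - 1 / sqdist s i j).
Proof. by rewrite /radial_term /cross !mulrA. Qed.

Lemma angular_termE i j : i != j -> angular_term s i j =
  (inner s i j / radius s j ^+ 2
   - 2 * inner s i j ^+ 2 / (radius s i ^+ 2 * radius s j ^+ 2) + 1)
  / sqdist s i j.
Proof.
move=> ij; rewrite /angular_term /inner (_ : 2 * dangle s i j = dangle s i j *+ 2).
  rewrite cos_mulr2n; field; rewrite !radius_neq0 sqdist_neq0 //.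
by rewrite mulr_natl.
Qed.

Lemma vortex_field_config : vortex_field eps mu s = 0.
Proof.
apply/rowP => k; rewrite [RHS]mxE /vortex_field; case: (split_ordP k) => i ->.
  rewrite row_mxEl mxE; apply: (mulfI (radius_neq0 i)).
  have -> : rdot eps mu s i = eps * \sum_(j | j != i) mu j * radial_term s i j.
    by congr (_ * _); apply: eq_bigr => j _; rewrite /radial_term !mulrA.
  rewrite mulrCA big_distrr /= mulr0.
  under eq_bigr => j _ do rewrite mulrCA radius_radial_term.
  move: i; apply: ord3P; rewrite ?sum3_neq0 ?sum3_neq1 ?sum3_neq2 !geometryE;
    by rewrite /eps0 /strength !tripleE; field.
rewrite row_mxEr mxE.
have -> : thetadot eps mu s i = - 1 + (1 + eps * mu i) / radius s i ^+ 2
    + eps * \sum_(j | j != i) mu j * angular_term s i j by [].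
move: i; apply: ord3P; rewrite ?sum3_neq0 ?sum3_neq1 ?sum3_neq2 !angular_termE //;
  by rewrite !geometryE /eps0 /strength !tripleE; field.
Qed.

(** Multiplying by r_i, or dividing dr_i by r_i, leaves only squares of radii,
    which are rational. *)
Lemma radius_dradial_term i j u : radius s i * dradial_term s i j u =
  (cross s i j * dlog s u j + inner s i j * dangle u i j)
     * (1 / radius s j ^+ 2 - 1 / sqdist s i j)
   + cross s i j * (dsqdist s i j u / sqdist s i j ^+ 2
                    - 2 * dlog s u j / radius s j ^+ 2).
Proof. by rewrite /dradial_term mulVKf ?radius_neq0. Qed.

Lemma dlog_T u i : dlog s (T u) i =
  (eps * \sum_(j | j != i) mu j * (radius s i * dradial_term s i j u))
  / radius s i ^+ 2.
Proof.
rewrite /dlog /dvortex_field /radius row_mxEl mxE -/(radius s i).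
under [in RHS]eq_bigr => j _ do rewrite mulrCA.
by rewrite -big_distrr /=; field; exact: radius_neq0.
Qed.

Lemma angle_T u i : angle (T u) i =
  - 2 * (1 + eps * mu i) / radius s i ^+ 2 * dlog s u i
  + eps * \sum_(j | j != i) mu j * dangular_term s i j u.
Proof. by rewrite /dvortex_field /angle row_mxEr mxE. Qed.

(* The coordinates of u are generalized: what remains is an identity between
   linear forms in six variables, over the rationals extended by w. *)
Ltac check_linearization u :=
  rewrite ?radius_dradial_term /dangular_term /dsqdist /dangle !geometryE;
  rewrite /formA /formB /eps0 /strength !tripleE;
  move: (dlog s u i0) (dlog s u i1) (dlog s u i2) => f0 f1 f2;
  move: (angle u i0) (angle u i1) (angle u i2) => t0 t1 t2;
  by field: w2.

Lemma dlog_linearization u i : dlog s (T u) i =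
  (w * formA (dlog s u) i + formB (angle u) i) / 41.
Proof.
move: i; apply: ord3P; rewrite dlog_T ?sum3_neq0 ?sum3_neq1 ?sum3_neq2.
- check_linearization u.
- check_linearization u.
- check_linearization u.
Qed.

Lemma angle_linearization u i : angle (T u) i =
  (formB (dlog s u) i - w * formA (angle u) i) / 41 - 2 * dlog s u i.
Proof.
move: i; apply: ord3P; rewrite angle_T ?sum3_neq0 ?sum3_neq1 ?sum3_neq2.
- check_linearization u.
- check_linearization u.
- check_linearization u.
Qed.

Lemma second_iterate_T u i :
  dlog s (T (T u)) i
    = (formP (dlog s u) i + w * formQ (angle u) i) / (11 * 41 ^+ 2) /\
  angle (T (T u)) i
    = (formP (angle u) i - w * formQ (dlog s u) i) / (11 * 41 ^+ 2).
Proof.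
rewrite dlog_linearization angle_linearization.
apply: second_iterate => // j;
  [exact: dlog_linearization | exact: angle_linearization].
Qed.

Lemma biquadratic_T u :
  moment_re w (dlog s u) (angle u) = 0 -> moment_im w (dlog s u) (angle u) = 0 ->
  T (T (T (T u))) + trace_coef R *: T (T u) + minor_coef R *: u = 0.
Proof.
move=> re0 im0.
have tt i : dlog s (T (T (T (T u)))) i + trace_coef R * dlog s (T (T u)) i
      + minor_coef R * dlog s u i = 0 /\
    angle (T (T (T (T u)))) i + trace_coef R * angle (T (T u)) i
      + minor_coef R * angle u i = 0.
  have [-> ->] := second_iterate_T (T (T u)) i.
  have [] := @fourth_iterate R w w2 (dlog s u) (angle u)
    (dlog s (T (T u))) (angle (T (T u))) _ _ i.
  - by move=> j; have [] := second_iterate_T u j.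
  - by move=> j; have [] := second_iterate_T u j.
  by rewrite re0 im0 mulr0.
move: (T (T u)) (T (T (T (T u)))) tt => y x tt.
apply/rowP => k; rewrite !mxE; case: (split_ordP k) => i ->; have [dl an] := tt i.
  apply: (mulIf (invr_neq0 (radius_neq0 i))).
  by rewrite mul0r -[RHS]dl /dlog /radius !mulrDl !mulrA.
exact: an.
Qed.

Lemma dX_dcartesian u i :
  dX i (dcartesian s u) = a * (xs R i * dlog s u i - w / 3 * ys R i * angle u i).
Proof. by rewrite /dX row_mxEl mxE s_cos s_sin; ring. Qed.

Lemma dY_dcartesian u i :
  dY i (dcartesian s u) = a * (w / 3 * ys R i * dlog s u i + xs R i * angle u i).
Proof. by rewrite /dY row_mxEr mxE s_cos s_sin; ring. Qed.

Lemma total_circulation : \sum_i circulation eps mu i = 287 / 143.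
Proof. by rewrite !big_ord_recl big_ord0 !GamE; field. Qed.

(** The symplectic form is the imaginary part of
    sum Gamma_k du_k conj(dv_k) - (sum Gamma du) conj(sum Gamma dv) / Gamma_T.
    With du_k = Z_k zeta_k it is Im h(zeta) for dv = Z, and - Re h(zeta) for
    dv = i Z. *)
Lemma moment_rotation u : moment eps mu s (rotation_dir R) u =
  - moment_re w (dlog s u) (angle u) / (286 * 143).
Proof.
have d0 i : dlog s (rotation_dir R) i = 0.
  by rewrite /dlog /radius row_mxEl mxE mul0r.
have d1 i : angle (rotation_dir R) i = 1 by rewrite /angle row_mxEr mxE.
rewrite /moment /Omega /wedge total_circulation !sum3 !dX_dcartesian.
rewrite !dY_dcartesian !d0 !d1 /circulation !liftK /moment_re.
rewrite /eps0 /strength /xs /ys !tripleE.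
move: (dlog s u i0) (dlog s u i1) (dlog s u i2) => f0 f1 f2.
move: (angle u i0) (angle u i1) (angle u i2) => t0 t1 t2.
(* a^2 * 16 / (123 * 143) = 1 / (286 * 143) *)
transitivity (- (16 / (123 * 143)) * a ^+ 2 *
  moment_re w (triple f0 f1 f2) (triple t0 t1 t2)); rewrite /moment_re !tripleE.
  by field: w2.
by rewrite a2; field.
Qed.

Lemma moment_scaling u : moment eps mu s (scaling_dir s) u =
  moment_im w (dlog s u) (angle u) / (286 * 143).
Proof.
have d0 i : dlog s (scaling_dir s) i = 1.
  by rewrite /dlog {1}/radius row_mxEl mxE mulfV ?radius_neq0.
have d1 i : angle (scaling_dir s) i = 0 by rewrite /angle row_mxEr mxE.
rewrite /moment /Omega /wedge total_circulation !sum3 !dX_dcartesian.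
rewrite !dY_dcartesian !d0 !d1 /circulation !liftK /moment_im.
rewrite /eps0 /strength /xs /ys !tripleE.
move: (dlog s u i0) (dlog s u i1) (dlog s u i2) => f0 f1 f2.
move: (angle u i0) (angle u i1) (angle u i2) => t0 t1 t2.
transitivity (16 / (123 * 143) * a ^+ 2 *
  moment_im w (triple f0 f1 f2) (triple t0 t1 t2)); rewrite /moment_im !tripleE.
  by field: w2.
by rewrite a2; field.
Qed.

Lemma config_linearly_stable :
  polar_of (config w a) s -> linearly_stable eps mu (config w a).
Proof.
move=> polar.
apply: (@linearly_stableP R eps mu s radius_neq0 sqdist_neq0
  (trace_coef R) (minor_coef R)) => //.
- by rewrite /trace_coef; lra.
- by rewrite /minor_coef; lra.
- by rewrite /trace_coef /minor_coef; lra.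
- exact: vortex_field_config.
have c0 : (286 * 143 : R)^-1 != 0 by rewrite invr_eq0 mulf_eq0 !pnatr_eq0.
move=> u /=; rewrite !moment_rotation !moment_scaling.
move=> /eqP; rewrite mulf_eq0 (negPf c0) orbF oppr_eq0 => /eqP re0.
move=> /eqP; rewrite mulf_eq0 (negPf c0) orbF => /eqP im0.
have [-> ->] := moment_step w2 (dlog_linearization u) (angle_linearization u).
by rewrite re0 mulr0 oppr0 mul0r; split=> //; exact: biquadratic_T.
Qed.

End Stability.

Theorem theorem9 (R : realType) :
  exists (eps : R) (mu : 'I_3 -> R) (q : 'I_4 -> 'rV[R]_2),
    [/\ [/\ 0 < eps,
            forall i, mu i != 0 &
            \sum_i circulation eps mu i != 0],
        relative_equilibrium (circulation eps mu) 1 q,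
        linearly_stable eps mu q &
        ~ has_line_of_symmetry q].
Proof.
pose w : R := Num.sqrt 39; pose a : R := Num.sqrt (123 / 4576).
have w2 : w ^+ 2 = 39 by rewrite sqr_sqrtr ?ler0n.
have a2 : a ^+ 2 = 123 / 4576 by rewrite sqr_sqrtr ?divr_ge0 ?ler0n.
have w0 : 0 < w by rewrite sqrtr_gt0 ltr0n.
have a0 : 0 < a by rewrite sqrtr_gt0 divr_gt0 ?ltr0n.
clearbody w a.
have /choice[p pP] : forall i : 'I_3, exists p : R * R,
    [/\ 0 < p.1, a * xs R i = p.1 * cos p.2
      & a * (w / 3) * ys R i = p.1 * sin p.2].
  move=> i; have [|r [t [r0 rc rs]]] :=
    @polar_coordinates R (a * xs R i) (a * (w / 3) * ys R i); last by exists (r, t).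
  rewrite !mulf_eq0 (gt_eqF a0) (gt_eqF w0) invr_eq0 pnatr_eq0 /=.
  by move: i; apply: ord3P; rewrite /xs /ys !tripleE pnatr_eq0 ?orbT.
pose s : 'rV[R]_(3 + 3) := row_mx (\row_i (p i).1) (\row_i (p i).2).
have radE i : radius s i = (p i).1 by rewrite /radius row_mxEl mxE.
have angE i : angle s i = (p i).2 by rewrite /angle row_mxEr mxE.
have s_gt0 i : 0 < radius s i by rewrite radE; have [] := pP i.
have s_cos i : radius s i * cos (angle s i) = a * xs R i.
  by rewrite radE angE; have [_ ->] := pP i.
have s_sin i : radius s i * sin (angle s i) = a * (w / 3) * ys R i.
  by rewrite radE angE; have [_ _ ->] := pP i.
exists (eps0 R), (strength R), (config w a); split.
- split.
  + by rewrite divr_gt0 ?ltr0n.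
  + by apply: ord3P; rewrite /strength !tripleE pnatr_eq0.
  + by rewrite total_circulation mulf_neq0 ?invr_eq0 ?pnatr_eq0.
- exact: config_relative_equilibrium.
- apply: (config_linearly_stable w2 a2 s_gt0 s_cos s_sin) => i; split=> //.
    rewrite s_cos !mxE /px /heliocentric unlift_none liftK /=; ring.
  rewrite s_sin !mxE /py /heliocentric unlift_none liftK /=; ring.
- exact: config_asymmetric.
Qed.
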